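(* Consider $N=2$ files, $K=2$ users, subpacketization $3$ and cache size $M=1$. If the cache contents are not allowed to be coded (i.e. linear combinations of two or more file parts are not allowed to be stored in a cache, so each cache simply stores three of the six subfiles), then rate $R=2/3$ cannot be achieved with demand privacy using a linear scheme.
   Context: Linear scheme with $2$ users, $2$ files $A,B$ and subpacketization $f$: each file is split into $f$ equal-size subfiles $A_0,\dots,A_{f-1}$, $B_0,\dots,B_{f-1}$, regarded as independent uniform symbols (or vectors of symbols) over a finite field $\mathbb F$; put $S=(A_0,\dots,A_{f-1},B_0,\dots,B_{f-1})^T$. Placement phase: the server gives User $i\in\{0,1\}$ the cache $Z_i=\mathsf C_iS$, where $\mathsf C_i$ is an $fM\times 2f$ matrix over $\mathbb F$ ($M$ is the cache size in files). The pair $(\mathsf C_0,\mathsf C_1)$ may be chosen at random according to a publicly known distribution; the realized $\mathsf C_i$ (the header $\Theta(Z_i)$) is known only to the server and User $i$. Delivery phase: the demands $D_0,D_1$ are i.i.d. uniform on $\{A,B\}$, independent of the files and of $(\mathsf C_0,\mathsf C_1)$, and are sent privately to the server. Depending on $(\mathsf C_0,\mathsf C_1,D_0,D_1)$ (possibly with additional randomness), the server chooses an $fR\times 2f$ matrix $T$ over $\mathbb F$ and multicasts $X=TS$ together with the header $\Theta(X)=T$ ($R$ is the rate). Decodability: for every realization, User $i$ can recover all subfiles of file $D_i$ as linear combinations of the entries of $Z_i$ and $X$. Demand privacy: $I(D_i,Z_i,\Theta(Z_i),X,\Theta(X);D_j)=0$ for $i\neq j$. Here $f=3$, $M=1$,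 $R=2/3$, so a cache holds $3$ subfiles and a transmission consists of $2$ linear combinations of the six subfiles. *)

(* Defs.v *)
From mathcomp Require Import all_boot all_order all_algebra.
From mathcomp Require Import reals exp.

Set Implicit Arguments.
Unset Strict Implicit.
Unset Printing Implicit Defensive.

Import Order.TTheory GRing.Theory Num.Theory.
Local Open Scope ring_scope.

Section FiniteProbability.
Variable R : realType.

Definition is_pmf (T : finType) (p : T -> R) : Prop :=
  (forall x, 0 <= p x) /\ \sum_x p x = 1.

Definition law (Omega T : finType) (mu : Omega -> R) (X : Omega -> T) (t : T)
    : R :=
  \sum_(w | X w == t) mu w.

(* Shannon entropy in nats; the term for a null value t vanishes, whatever the
   value of ln 0. *)
Definition entropy (Omega T : finType) (mu : Omega -> R) (X : Omega -> T) : R :=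
  - \sum_t law mu X t * ln (law mu X t).

Definition mutual_info (Omega T U : finType) (mu : Omega -> R)
    (X : Omega -> T) (Y : Omega -> U) : R :=
  entropy mu X + entropy mu Y - entropy mu (fun w => (X w, Y w)).

End FiniteProbability.

(* File A is encoded by false and file B by true. *)
Notation file := bool.

Notation user := 'I_2.
Notation demands := {ffun user -> file}.
Notation caching F f k := {ffun user -> 'M[F]_(k, f + f)}.
Notation outcome F f k r l :=
  (caching F f k * demands * 'M[F]_(f + f, l) * 'M[F]_(r, f + f))%type.

Section LinearScheme.
Variables (F : finFieldType) (R : realType).

(* The files are U = (A_0, ..., A_{f-1}, B_0, ..., B_{f-1})^T, one row for each
   subfile; a subfile is a vector of l symbols of F. *)
Definition subfiles (f l : nat) (d : file) (U : 'M[F]_(f + f, l)) : 'M[F]_(f, l) :=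
  if d then dsubmx U else usubmx U.

(* [k] is the number f * M of rows of a cache matrix, and [r] the number f * R
   of rows of a transmission matrix.  [placement] is the joint law of (C_0, C_1)
   and [delivery C D] is the conditional law of T given the cache matrices and
   the demands, which accounts for any additional randomness of the server. *)
Record linear_scheme (f k r : nat) := LinearScheme {
  placement : caching F f k -> R;
  delivery : caching F f k -> demands -> 'M[F]_(r, f + f) -> R;
  placement_pmf : is_pmf placement;
  delivery_pmf : forall C D, is_pmf (delivery C D)
}.

(* The cache matrices, the demands and the files are independent; the demands
   and the files are uniform; T is drawn without looking at the files. *)
Definition joint_law (f k r l : nat) (s : linear_scheme f k r)
    (w : outcome F f k r l) : R :=
  let: (C, D, U, T) := w in
  placement s C * #|{: demands}|%:R^-1 * #|{: 'M[F]_(f + f, l)}|%:R^-1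
    * delivery s C D T.

Definition demand_of (f k r l : nat) (j : user) (w : outcome F f k r l) : file :=
  let: (C, D, U, T) := w in D j.

(* (D_i, Z_i, Theta(Z_i), X, Theta(X)) *)
Definition view (f k r l : nat) (i : user) (w : outcome F f k r l)
    : file * 'M[F]_(k, l) * 'M[F]_(k, f + f) * 'M[F]_(r, l) * 'M[F]_(r, f + f) :=
  let: (C, D, U, T) := w in (D i, C i *m U, C i, T *m U, T).

(* The coefficients G of the linear combinations may depend on the matrices and
   the demands, but not on the content of the files. *)
Definition decodable (f k r l : nat) (s : linear_scheme f k r) : Prop :=
  forall (C : caching F f k) (D : demands) (T : 'M[F]_(r, f + f)),
    0 < placement s C -> 0 < delivery s C D T ->
  forall i : user, exists G : 'M[F]_(f, k + r),
  forall U : 'M[F]_(f + f, l),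
    G *m col_mx (C i *m U) (T *m U) = subfiles (D i) U.

Definition demand_private (f k r l : nat) (s : linear_scheme f k r) : Prop :=
  forall i j : user, i != j ->
    mutual_info (@joint_law f k r l s) (view i) (demand_of j) = 0.

(* Every cached symbol involves at most one subfile. *)
Definition uncoded_placement (f k r : nat) (s : linear_scheme f k r) : Prop :=
  forall C : caching F f k, 0 < placement s C ->
  forall (i : user) (a : 'I_k), (#|[set j | C i a j != 0%R]| <= 1)%N.

Definition uncoded_private_achievable (f l : nat) (cache rate : rat) : Prop :=
  exists k r : nat,
    [/\ k%:R = f%:R * cache, r%:R = f%:R * rate &
     exists s : linear_scheme f k r,
       [/\ uncoded_placement s, decodable l s & demand_private l s]].

End LinearScheme.

(* Main.v *)
(* Vanishing mutual information forces the support of (view, other demand) to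
   be a product: in any realizable configuration the demand of one user can be
   flipped without changing what the other user sees. The rest is linear algebra
   on the realizable configurations. Three uncoded cached symbols, together with
   two transmitted ones, can serve both demands only if, for one of the files d,
   the cache holds at most one subfile of d and misses a subfile of the other
   file; call it a cache of type d. Let the first cache be of type d, and start
   from the demands (d, d). If both caches are of type d, the missed subfiles differ,
   and T does not involve them; flipping first one demand and then the other, T
   must serve two users of type d which both miss the third subfile, hence the
   same one. If the second cache is of the other type, then it holds precisely
   the subfile missed by the first, so that T contains a combination of subfiles
   of d only; after flipping the second demand, the second user is again of the
   other type, by the first case, and T must be injective on the subfiles of the
   other file. *)

Require Import Defs.
From mathcomp Require Import all_boot all_order all_algebra.
From mathcomp Require Import reals exp.
From mathcomp Require Import ring lra.

Set Implicit Arguments.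
Unset Strict Implicit.
Unset Printing Implicit Defensive.

Import Order.TTheory GRing.Theory Num.Theory.
Local Open Scope ring_scope.

(** * Finite probability: supports and vanishing mutual information *)

Lemma pmf_gt0_ex (R : realType) (T : finType) (p : T -> R) :
  is_pmf p -> exists x, 0 < p x.
Proof.
move=> [p_ge0 p1].
have /(psumr_neq0P (fun x _ => p_ge0 x))[x px] : \sum_x p x <> 0.
  by rewrite p1; exact/eqP/oner_neq0.
by exists x.
Qed.

Section Support.
Variables (R : realType) (Omega T U : finType) (mu : Omega -> R).
Hypothesis mu_pmf : is_pmf mu.

Lemma law_ge0 (X : Omega -> T) t : 0 <= law mu X t.
Proof. by apply: sumr_ge0 => w _; case: mu_pmf. Qed.

Lemma law_gt0 (X : Omega -> T) w : 0 < mu w -> 0 < law mu X (X w).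
Proof.
move=> w_gt0; rewrite /law (bigD1 w) //= ltr_wpDr //.
by apply: sumr_ge0 => v _; case: mu_pmf.
Qed.

Lemma law_gt0_ex (X : Omega -> T) t :
  0 < law mu X t -> exists2 w, X w = t & 0 < mu w.
Proof.
have [mu_ge0 _] := mu_pmf => /lt0r_neq0/eqP.
by case/(psumr_neq0P (fun w _ => mu_ge0 w)) => w /andP[/eqP]; exists w.
Qed.

Lemma sum_law (X : Omega -> T) : \sum_t law mu X t = 1.
Proof.
by have [_ <-] := mu_pmf; rewrite (partition_big X xpredT).
Qed.

Lemma law_fst (X : Omega -> T) (Y : Omega -> U) t :
  law mu X t = \sum_u law mu (fun w => (X w, Y w)) (t, u).
Proof.
by rewrite /law (partition_big Y xpredT) //=; apply: eq_bigr.
Qed.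

Lemma law_snd (X : Omega -> T) (Y : Omega -> U) u :
  law mu Y u = \sum_t law mu (fun w => (X w, Y w)) (t, u).
Proof.
rewrite /law (partition_big X xpredT) //=; apply: eq_bigr => t _.
by apply: eq_bigl => w; rewrite xpair_eqE andbC.
Qed.

End Support.

(** The bound [ln x <= x - 1] at [x = q / p], which is Gibbs' inequality term by term. *)
Lemma mul_ln_ge (R : realType) (p q : R) :
  0 < p -> 0 < q -> p - q <= p * (ln p - ln q).
Proof.
move=> p_gt0 q_gt0.
have qp_gt0 : 0 < q / p by rewrite divr_gt0.
have h : ln (q / p) <= q / p - 1.
  by have := @le_ln1Dx R (q / p - 1); rewrite [1 + _]addrC subrK; apply; lra.
rewrite ln_div ?posrE // in h.
have := ler_wpM2l (ltW p_gt0) h.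
by rewrite !mulrBr mulr1 mulrCA divff ?gt_eqF // mulr1; lra.
Qed.

Lemma mutual_info_eq0_law_gt0 (R : realType) (Omega T U : finType)
    (mu : Omega -> R) (X : Omega -> T) (Y : Omega -> U) (t : T) (u : U) :
  is_pmf mu -> mutual_info mu X Y = 0 ->
  0 < law mu X t -> 0 < law mu Y u ->
  0 < law mu (fun w => (X w, Y w)) (t, u).
Proof.
move=> mu_pmf I0 t_gt0 u_gt0.
set p := law mu (fun w => (X w, Y w)); set a := law mu X; set b := law mu Y.
have p_ge0 z : 0 <= p z by exact: law_ge0.
have a_ge0 x : 0 <= a x by exact: law_ge0.
have b_ge0 y : 0 <= b y by exact: law_ge0.
(* Where the joint law is positive, so are both marginals, and the logarithms below have positive
   arguments. *)
have p_le_a z : p z <= a z.1.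
  rewrite /a (law_fst _ _ Y) (bigD1 z.2) //= -surjective_pairing lerDl.
  by apply: sumr_ge0 => *; exact: law_ge0.
have p_le_b z : p z <= b z.2.
  rewrite /b (law_snd _ X) (bigD1 z.1) //= -surjective_pairing lerDl.
  by apply: sumr_ge0 => *; exact: law_ge0.
(* The information is the sum of the gaps, which are nonnegative and hence
   null; but at a null p z the gap is the product of the marginals. *)
pose gap z := p z * (ln (p z) - ln (a z.1) - ln (b z.2))
              - (p z - a z.1 * b z.2).
have gap_ge0 z : 0 <= gap z.
  rewrite /gap; have [<-|pz_neq0] := eqVneq 0 (p z).
    by rewrite mul0r !sub0r opprK mulr_ge0.
  have pz_gt0 : 0 < p z by rewrite lt0r eq_sym pz_neq0 p_ge0.
  have az_gt0 := lt_le_trans pz_gt0 (p_le_a z).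
  have bz_gt0 := lt_le_trans pz_gt0 (p_le_b z).
  have := mul_ln_ge pz_gt0 (mulr_gt0 az_gt0 bz_gt0).
  by rewrite lnM ?posrE // opprD addrA subr_ge0.
have sum_gap : \sum_z gap z = 0.
  rewrite sumrB sumrB (sum_law mu_pmf).
  have -> : \sum_z a z.1 * b z.2 = 1.
    rewrite -(pair_bigA _ (fun x y => a x * b y)) /=.
    under eq_bigr => x _ do rewrite -mulr_sumr (sum_law mu_pmf) mulr1.
    exact: sum_law.
  rewrite subrr subr0 -[RHS]I0 /mutual_info /entropy -/a -/b -/p.
  have -> : \sum_x a x * ln (a x) = \sum_z p z * ln (a z.1).
    rewrite -(pair_bigA _ (fun x y => p (x, y) * ln (a x))) /=.
    apply: eq_bigr => x _; rewrite -mulr_suml; congr (_ * _).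
    exact: law_fst.
  have -> : \sum_y b y * ln (b y) = \sum_z p z * ln (b z.2).
    transitivity (\sum_x \sum_y p (x, y) * ln (b y)); last first.
      by rewrite pair_bigA /=; apply: eq_bigr => -[].
    rewrite exchange_big /=.
    apply: eq_bigr => y _; rewrite -mulr_suml; congr (_ * _).
    exact: law_snd.
  under eq_bigr => z _ do rewrite !mulrBr.
  by rewrite !sumrB; ring.
have : gap (t, u) = 0 by exact: (psumr_eq0P (fun z _ => gap_ge0 z) sum_gap).
rewrite /gap /= => gap_tu; rewrite lt0r p_ge0 andbT; apply/eqP => p_tu.
have := mulr_gt0 t_gt0 u_gt0.
by move: gap_tu; rewrite p_tu mul0r !sub0r opprK -/a -/b => ->; rewrite ltxx.
Qed.

(** * Linear algebra of one cache and one transmission *)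

Section LinearAlgebra.
Variable F : fieldType.

Definition file_idx f (d : file) (y : 'I_f) : 'I_(f + f) :=
  if d then rshift f y else lshift f y.

Lemma file_idx_inj f d : injective (@file_idx f d).
Proof. by case: d; [exact: rshift_inj | exact: lshift_inj]. Qed.

Lemma file_idx_disjoint f (x y : 'I_f) : file_idx false x != file_idx true y.
Proof. by rewrite /= eq_lrshift. Qed.

(** Decoding expressed on coefficient vectors, so that the file contents disappear. *)
Definition recovers f k r (d : file) (C : 'M[F]_(k, f + f))
    (T : 'M[F]_(r, f + f)) : Prop :=
  forall y : 'I_f, exists g h,
    g *m C + h *m T = delta_mx 0 (file_idx d y) :> 'rV[F]_(f + f).

(** A cache of type [d]: [al] is the one index of [d] that may be present, though it need not be. *)
Definition confined f k (d : file) (al be : 'I_f)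
    (C : 'M[F]_(k, f + f)) : Prop :=
  (forall y, y != al -> col (file_idx d y) C = 0)
  /\ col (file_idx (~~ d) be) C = 0.

Lemma mulmx_col0 k n (g : 'rV[F]_k) (C : 'M[F]_(k, n)) j :
  col j C = 0 -> (g *m C) 0 j = 0.
Proof.
move=> /colP Cj0; rewrite mxE big1 // => i _.
by move: (Cj0 i); rewrite !mxE => ->; rewrite mulr0.
Qed.

(* The columns (d, y), y != al, of T form a square matrix, which is invertible:
   the decoding coefficients provide a left inverse. *)
Lemma recovers_own n k (d : file) (al be : 'I_n.+1)
    (C : 'M[F]_(k, n.+1 + n.+1)) (T : 'M[F]_(n, n.+1 + n.+1)) :
  confined d al be C -> recovers d C T ->
  [/\ col (file_idx (~~ d) be) T = 0,
      forall y, y != al -> col (file_idx d y) T != 0 &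
      forall x : 'rV[F]_n,
        (forall y, y != al -> (x *m T) 0 (file_idx d y) = 0) -> x = 0].
Proof.
move=> [C_d C_nd] rec.
have {}rec y : exists h : 'rV[F]_n,
    [/\ (h *m T) 0 (file_idx (~~ d) be) = 0 &
     forall z, z != al -> (h *m T) 0 (file_idx d z) = (z == y)%:R].
  have [g [h /rowP gh]] := rec y; exists h; split=> [|z z_al].
    move: (gh (file_idx (~~ d) be)).
    rewrite mxE (mulmx_col0 _ C_nd) add0r => ->.
    rewrite mxE eqxx /=; case: {+}d => /=.
      by rewrite eq_lrshift.
    by rewrite eq_rlshift.
  move: (gh (file_idx d z)).
  rewrite mxE (mulmx_col0 _ (C_d z z_al)) add0r => ->.
  by rewrite mxE eqxx (inj_eq (@file_idx_inj _ _)).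
have /fin_all_exists[h h_rec] := fun i : 'I_n => rec (lift al i).
pose H := \matrix_(i < n) h i.
pose T' := colsub (fun i : 'I_n => file_idx d (lift al i)) T.
have HT' : H *m T' = 1%:M.
  apply/matrixP => i j; have [_ /(_ (lift al j))] := h_rec i.
  rewrite eq_sym neq_lift => /(_ isT); rewrite (inj_eq lift_inj) => hij.
  rewrite mxE [RHS]mxE eq_sym -hij mxE.
  by apply: eq_bigr => s _; rewrite !mxE.
have T'H := mulmx1C HT'.
split.
(* The rows of [H] decode subfiles of [d], hence vanish on the missed column; invertibility of [H]
   passes this on to [T]. *)
- rewrite -[LHS]mul1mx -T'H -mulmxA.
  suff -> : H *m col (file_idx (~~ d) be) T = 0.
    by rewrite mulmx0.
  apply/colP => i; have [hi _] := h_rec i; rewrite [RHS]mxE -hi !mxE.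
  by apply: eq_bigr => s _; rewrite !mxE.
- move=> y y_al; apply/eqP => Ty0.
  have [h0 [_ /(_ y y_al)]] := rec y.
  by rewrite (mulmx_col0 _ Ty0) eqxx => /esym/eqP; rewrite oner_eq0.
- move=> x x0; rewrite -[x]mulmx1 -T'H mulmxA; suff -> : x *m T' = 0.
    by rewrite mul0mx.
  apply/rowP => j.
  rewrite [RHS]mxE -(x0 (lift al j)) ?[_ == al]eq_sym ?neq_lift //.
  by rewrite !mxE; apply: eq_bigr => s _; rewrite !mxE.
Qed.

(** The cache contributes nothing at these columns, so there the decoding of subfile [be] rests on
    [T] alone. *)
Lemma recovers_other f k r (d : file) (al be : 'I_f)
    (C : 'M[F]_(k, f + f)) (T : 'M[F]_(r, f + f)) :
  confined d al be C -> recovers (~~ d) C T ->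
  exists x : 'rV[F]_r, (x *m T) 0 (file_idx (~~ d) be) = 1 /\
    forall y, y != al -> (x *m T) 0 (file_idx d y) = 0.
Proof.
move=> [C_d C_nd] /(_ be)[g [h /rowP gh]]; exists h; split=> [|z z_al].
  move: (gh (file_idx (~~ d) be)).
  by rewrite mxE (mulmx_col0 _ C_nd) add0r => ->; rewrite mxE !eqxx.
move: (gh (file_idx d z)); rewrite mxE (mulmx_col0 _ (C_d z z_al)) add0r => ->.
rewrite mxE eqxx /=; case: {+}d => /=.
  by rewrite eq_rlshift.
by rewrite eq_lrshift.
Qed.

Definition stored f k (C : 'M[F]_(k, f + f)) (d : file) : {set 'I_f} :=
  [set y | col (file_idx d y) C != 0].

(** Every nonzero column has a nonzero cell in some row, and an uncoded row accounts for at most one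
    column. *)
Lemma card_stored f k (C : 'M[F]_(k, f + f)) :
  (forall a, #|[set j | C a j != 0%R]| <= 1)%N ->
  (#|stored C false| + #|stored C true| <= k)%N.
Proof.
move=> uncoded.
pose cells := (@file_idx f false @: stored C false)
  :|: (@file_idx f true @: stored C true).
have card_cells : #|cells| = (#|stored C false| + #|stored C true|)%N.
  rewrite cardsU disjoint_setI0 ?cards0 ?subn0.
    by rewrite !card_imset //; exact: file_idx_inj.
  apply/pred0P => j /=; apply/andP => -[/imsetP[x _ ->] /imsetP[y _]] /eqP.
  by rewrite (negPf (file_idx_disjoint x y)).
pose pick_cell (a : 'I_k) := [pick j | C a j != 0].
have cells_sub : Some @: cells \subset [set pick_cell a | a : 'I_k].
  apply/subsetP => _ /imsetP[j j_cell ->].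
  have : col j C != 0.
    by case/setUP: j_cell => /imsetP[y]; rewrite inE => Cy ->.
  case/cV0Pn=> a; rewrite mxE => Caj; apply/imsetP; exists a => //.
  rewrite /pick_cell; case: pickP => [j' Caj' | /(_ j)]; last by rewrite Caj.
  by have/card_le1_eqP/(_ j j') := uncoded a; rewrite !inE => ->.
rewrite -card_cells -(card_imset _ (@Some_inj _)).
by rewrite (leq_trans (subset_leq_card cells_sub))
  ?(leq_trans (leq_imset_card _ _)) ?card_ord.
Qed.

(** Otherwise [T] alone would decode [f] independent subfiles with rank at most [r]. *)
Lemma stored_gt0 f k r (d : file) (C : 'M[F]_(k, f + f))
    (T : 'M[F]_(r, f + f)) :
  (r < f)%N -> recovers d C T -> (0 < #|stored C d|)%N.
Proof.
move=> r_lt_f rec; rewrite card_gt0; apply: contraL r_lt_f => /eqP stored0.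
rewrite -leqNgt.
have C0 y : col (file_idx d y) C = 0.
  by apply/eqP; move/setP/(_ y): stored0; rewrite !inE => /negbFE.
have /fin_all_exists[h h_rec] : forall y, exists h : 'rV[F]_r,
    forall z, (h *m T) 0 (file_idx d z) = (z == y)%:R.
  move=> y; have [g [h /rowP gh]] := rec y; exists h => z.
  move: (gh (file_idx d z)); rewrite mxE (mulmx_col0 _ (C0 z)) add0r => ->.
  by rewrite mxE eqxx (inj_eq (@file_idx_inj _ _)).
pose H := \matrix_(i < f) h i.
have HT : H *m colsub (@file_idx f d) T = 1%:M.
  apply/matrixP => i j; rewrite mxE [RHS]mxE eq_sym -h_rec mxE.
  by apply: eq_bigr => s _; rewrite !mxE.
by rewrite -(mxrank1 F f) -HT (leq_trans (mulmx_max_rank _ _)).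
Qed.

(** Each file occupies at least one of at most three stored positions, so one file has at most one
    and the other at most two. *)
Lemma uncoded_confined (C : 'M[F]_(3, 3 + 3)) (TA TB : 'M[F]_(2, 3 + 3)) :
  (forall a, #|[set j | C a j != 0%R]| <= 1)%N ->
  recovers false C TA -> recovers true C TB ->
  exists d al be, confined d al be C.
Proof.
move=> /card_stored le3 /(stored_gt0 (ltnSn 2)) gtA /(stored_gt0 (ltnSn 2)) gtB.
have stored0 d y : y \notin stored C d -> col (file_idx d y) C = 0.
  by rewrite inE negbK => /eqP.
suff [d [le1 le2]] : exists d,
    (#|stored C d| <= 1)%N /\ (#|stored C (~~ d)| <= 2)%N.
  have /subsetPn[be _ be_nd] : ~~ ([set: 'I_3] \subset stored C (~~ d)).
    by apply/negP => /subset_leq_card; rewrite cardsT card_ord leqNgt ltnS le2.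
  (* If nothing of [d] were stored, any index would do for [al]. *)
  exists d, (odflt ord0 [pick y in stored C d]), be.
  split=> [y y_al|]; apply: stored0 => //; apply: contraNN y_al => y_d.
  case: pickP => [z z_d | /(_ y)]; last by rewrite y_d.
  by apply/eqP; move/card_le1_eqP: le1; apply.
have [leA1 | gtA1] := leqP #|stored C false| 1; [exists false | exists true].
  by split=> //=; rewrite -ltnS (leq_trans _ le3) // -add1n leq_add2r.
split=> /=; first by rewrite -(leq_add2l 2) (leq_trans _ le3) // leq_add2r.
by rewrite -ltnS (leq_trans _ le3) // -addn1 leq_add2l.
Qed.

End LinearAlgebra.

(** * From probabilistic schemes to realizable configurations *)

Section Scheme.
Variables (F : finFieldType) (R : realType).

Lemma joint_law_pmf f k r l (s : linear_scheme F R f k r) :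
  is_pmf (@joint_law F R f k r l s).
Proof.
have [p_ge0 p_sum] := placement_pmf s.
have d_pmf C D := delivery_pmf s C D.
split=> [[[[C D] U] T]|].
  by rewrite !mulr_ge0 ?invr_ge0 ?ler0n //; case: (d_pmf C D).
have unif (I : finType) (x0 : I) (c : R) : \sum_(x : I) #|{: I}|%:R^-1 * c = c.
  rewrite sumr_const -[LHS]mulr_natr mulrAC mulVf ?mul1r //.
  by rewrite pnatr_eq0 -lt0n; apply/card_gt0P; exists x0.
transitivity (\sum_C \sum_(D : demands) \sum_(U : 'M[F]_(f + f, l)) \sum_T
    #|{: demands}|%:R^-1 * (#|{: 'M[F]_(f + f, l)}|%:R^-1
      * (placement s C * delivery s C D T))).
  rewrite !pair_bigA /=; apply: eq_bigr => -[[[C D] U] T] _ /=.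
  by rewrite !mulrA; congr (_ * _); rewrite -mulrA mulrC.
rewrite -[RHS]p_sum; apply: eq_bigr => C _.
rewrite -[RHS](unif _ ([ffun=> false] : demands)); apply: eq_bigr => D _.
under eq_bigr => U _ do rewrite -!mulr_sumr (d_pmf C D).2 mulr1.
by rewrite -mulr_sumr; congr (_ * _); exact: (unif _ 0).
Qed.

Variables (l k r f : nat) (s : linear_scheme F R f k r).

(** The support of the joint law: demands and files are uniform, so only these two factors can
    vanish. *)
Definition realizable (C : caching F f k) (D : demands)
    (T : 'M[F]_(r, f + f)) :=
  0 < placement s C /\ 0 < delivery s C D T.

Lemma delivery_ex C D : 0 < placement s C -> exists T, realizable C D T.
Proof.
by move=> C_gt0; have [T] := pmf_gt0_ex (delivery_pmf s C D); exists T.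
Qed.

Lemma joint_law_gt0 C D U T :
  0 < @joint_law F R f k r l s (C, D, U, T) <-> realizable C D T.
Proof.
rewrite /joint_law /realizable.
have [C_ge0 _] := placement_pmf s; have [T_ge0 _] := delivery_pmf s C D.
have gt0 (I : finType) (x : I) : 0 < #|{: I}|%:R^-1 :> R.
  by rewrite invr_gt0 ltr0n; apply/card_gt0P; exists x.
split=> [w_gt0 | [p_gt0 d_gt0]]; last first.
  by rewrite !mulr_gt0 //; [exact: gt0 D | exact: gt0 U].
by split; rewrite lt0r ?C_ge0 ?T_ge0 andbT; apply: contraTneq w_gt0 => ->;
  rewrite ?mulr0 ?mul0r ltxx.
Qed.

(** The view of [i] and the flipped demand of [j] each have positive probability, so privacy makes
    them occur together. The cache of [j] may change. *)
Lemma private_flip (i j : user) C D T :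
    demand_private l s -> i != j -> realizable C D T ->
  exists C' D', [/\ realizable C' D' T, C' i = C i, D' i = D i & D' j = ~~ D j].
Proof.
move=> priv i_j CDT; have pmf := @joint_law_pmf f k r l s.
pose D' : demands := [ffun u => if u == i then D i else ~~ D j].
have D'j : D' j = ~~ D j by rewrite ffunE eq_sym (negPf i_j).
have [T' CD'T'] := delivery_ex D' CDT.1.
have v_gt0 := law_gt0 pmf (view i) ((joint_law_gt0 C D 0 T).2 CDT).
have d_gt0 := law_gt0 pmf (demand_of j) ((joint_law_gt0 C D' 0 T').2 CD'T').
have := mutual_info_eq0_law_gt0 pmf (priv i j i_j) v_gt0 d_gt0.
case/(law_gt0_ex pmf) => -[[[C1 D1] U1] T1] /= [D1i _ C1i _ -> D1j].
by move=> /(joint_law_gt0 _ _ U1 _).1 C1D1T; exists C1, D1; rewrite -D'j.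
Qed.

(** Files with a single nonzero symbol read off the decoding coefficients column by column; [l_gt0]
    supplies a place for that symbol. *)
Lemma decodable_recovers C D T i :
  (0 < l)%N -> decodable l s -> realizable C D T -> recovers (D i) (C i) T.
Proof.
move=> l_gt0 dec [C_gt0 T_gt0] y; have [G GU] := dec C D T C_gt0 T_gt0 i.
exists (lsubmx (row y G)), (rsubmx (row y G)).
rewrite -mul_row_col hsubmxK; apply/rowP => j.
pose o := Ordinal l_gt0.
have mul_deltaE (A : 'M[F]_(f, f + f)) : (A *m delta_mx j o) y o = A y j.
  rewrite mxE (bigD1 j) //= mxE !eqxx mulr1 big1 ?addr0 // => z z_j.
  by rewrite mxE (negPf z_j) mulr0.
have := GU (delta_mx j o); rewrite -mul_col_mx mulmxA => /matrixP/(_ y o).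
rewrite mul_deltaE => GUy; rewrite -row_mul mxE GUy [RHS]mxE.
by rewrite eqxx /subfiles; case: (D i); rewrite !mxE eqxx andbT eq_sym.
Qed.

End Scheme.

(** * Excluding each pair of cache types *)

Section Impossibility.
Variables (F : finFieldType) (R : realType) (l : nat).
Variable s : linear_scheme F R 3 3 2.
Hypothesis l_gt0 : (0 < l)%N.
Hypothesis s_uncoded : uncoded_placement s.
Hypothesis s_decodable : decodable l s.
Hypothesis s_private : demand_private l s.

Let rec C D T i := @decodable_recovers F R l 3 2 3 s C D T i l_gt0 s_decodable.

(** The cache is placed before the demands, so the same [C i] must serve both files. *)
Lemma realizable_confined (C : caching F 3 3) D T i :
  realizable s C D T -> exists d al be, confined d al be (C i).
Proof.
move=> [C_gt0 _].
have [TA /(rec i)] := delivery_ex [ffun=> false] C_gt0.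
have [TB /(rec i)] := delivery_ex [ffun=> true] C_gt0.
rewrite !ffunE => recB recA.
exact: uncoded_confined (s_uncoded C_gt0 i) recA recB.
Qed.

(** Let [i] want [d] and [j] want [~~ d]: user [i] forces a null column at [be], while [j] needs a
    nonzero one at [be']. *)
Lemma same_confined_neq (i j : user) C D T d al al' be be' :
    i != j -> realizable s C D T ->
    confined d al be (C i) -> confined d al' be' (C j) ->
  be != be'.
Proof.
move=> i_j [C_gt0 _] Ci Cj.
have [T' CT'] := delivery_ex [ffun u => if u == i then d else ~~ d] C_gt0.
move: (rec i CT') (rec j CT').
rewrite !ffunE eqxx eq_sym (negPf i_j) => reci recj.
have [T'0 _ _] := recovers_own Ci reci.
have [x [xT1 _]] := recovers_other Cj recj.
apply: contra_eq_neq xT1 => be_be'.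
by rewrite -be_be' (mulmx_col0 _ T'0) eq_sym oner_neq0.
Qed.

Lemma same_confined_false (i j : user) C D T d al al' be be' :
    i != j -> realizable s C D T ->
  confined d al be (C i) -> confined d al' be' (C j) -> False.
Proof.
move=> i_j CT Ci Cj; have be_be' := same_confined_neq i_j CT Ci Cj.
have [T0 CT0] := delivery_ex [ffun=> d] CT.1.
move: (rec i CT0) (rec j CT0); rewrite !ffunE => reci recj.
have [T0be _ _] := recovers_own Ci reci.
have [T0be' _ _] := recovers_own Cj recj.
have third (M : 'M_(3, 3 + 3)) e a b :
    recovers (~~ d) M T0 -> confined e a b M -> [/\ e = d, b != be & b != be'].
  move=> recM Me; have [e_d | e_nd] := eqVneq e d.
    rewrite e_d in Me *; have [x [xT1 _]] := recovers_other Me recM.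
    split=> //; apply: contra_eq_neq xT1 => ->;
      by rewrite mulmx_col0 // eq_sym oner_neq0.
  (* A cache of type [~~ d] tolerates one null column of [T0] in its own file, but those of [be] and
     [be'] are both null. *)
  have {}e_nd : e = ~~ d by case: (e) (d) e_nd => [] [].
  rewrite e_nd in Me; have [_ Te _] := recovers_own Me recM.
  have [be_a | /Te] := eqVneq be a; last by rewrite T0be eqxx.
  by move: be_be'; rewrite eq_sym be_a => /Te; rewrite T0be' eqxx.
(* Both demands are flipped in turn under the same [T0]; the second flip keeps the cache that [j]
   got in the first. *)
have [C1 [D1 [CT1 _ D1i D1j]]] := private_flip s_private i_j CT0.
have j_i : j != i by rewrite eq_sym.
have [C2 [D2 [CT2 C2j D2j D2i]]] := private_flip s_private j_i CT1.
have [d1 [a1 [b1 C1j]]] := realizable_confined j CT1.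
have [d2 [a2 [b2 C2i]]] := realizable_confined i CT2.
move: (rec j CT1) (rec i CT2); rewrite D1j D2i D1i !ffunE => recj1 reci2.
have [d1d b1be b1be'] := third _ _ _ _ recj1 C1j.
have [d2d b2be b2be'] := third _ _ _ _ reci2 C2i.
rewrite -C2j in C1j; subst d1 d2.
(* Now [b1] and [b2] must differ, yet both avoid [be] and [be'] among only three indices. *)
have := same_confined_neq i_j CT2 C2i C1j.
move: be_be' b1be b1be' b2be b2be'.
by clear; case: be be' b1 b2 => [[|[|[|?]]] ?] [[|[|[|?]]] ?]
  [[|[|[|?]]] ?] [[|[|[|?]]] ?].
Qed.

Lemma opposite_confined_false (i j : user) C D T d al al' be be' :
    i != j -> realizable s C D T ->
  confined d al be (C i) -> confined (~~ d) al' be' (C j) -> False.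
Proof.
move=> i_j CT Ci Cj.
(* When each user wants the file of its own type, [be] gives a null column, while only [al'] may do
   so for [j]. *)
have al'_be : al' = be.
  have [T' CT'] := delivery_ex [ffun u => if u == i then d else ~~ d] CT.1.
  move: (rec i CT') (rec j CT').
  rewrite !ffunE eqxx eq_sym (negPf i_j) => reci recj.
  have [T'0 _ _] := recovers_own Ci reci.
  have [_ T'neq _] := recovers_own Cj recj.
  by apply/eqP; rewrite eq_sym; apply/negPn/negP => /T'neq; rewrite T'0 eqxx.
have [T0 CT0] := delivery_ex [ffun=> d] CT.1.
move: (rec i CT0) (rec j CT0); rewrite !ffunE => reci recj.
have [T0be _ _] := recovers_own Ci reci.
rewrite -[X in recovers X]negbK in recj.
have [x [xT1 xT0]] := recovers_other Cj recj.
(* The one column that [x] leaves open is [al'], that is [be], where [T0] itself is null. *)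
have xT0_all y : (x *m T0) 0 (file_idx (~~ d) y) = 0.
  have [-> | y_be] := eqVneq y be; first exact: mulmx_col0.
  by apply: xT0; rewrite al'_be.
have [C1 [D1 [CT1 C1i _ D1j]]] := private_flip s_private i_j CT0.
have [d1 [a1 [b1 C1j]]] := realizable_confined j CT1.
have d1_nd : d1 = ~~ d.
  apply/eqP; case: eqVneq => // d1_d; rewrite -C1i in Ci.
  have {}d1_d : d1 = d by case: (d1) (d) d1_d => [] [].
  by rewrite d1_d in C1j; case: (same_confined_false i_j CT1 Ci C1j).
rewrite d1_nd in C1j; move: (rec j CT1); rewrite D1j ffunE => recj1.
(* Serving [~~ d] to the new cache of [j] makes [T0] injective on the columns of [~~ d], where
   [x *m T0] vanishes. *)
have [_ _ /(_ x)x0] := recovers_own C1j recj1.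
by move: xT1; rewrite x0 // mul0mx mxE => /esym/eqP; rewrite oner_eq0.
Qed.

End Impossibility.

Theorem lemma4 (F : finFieldType) (R : realType) (l : nat) (l_gt0 : (0 < l)%N) :
  ~ @uncoded_private_achievable F R 3 l 1%R (2%:R / 3%:R)%R.
Proof.
move=> [k [r [k3 r2 [s [s_uncoded s_decodable s_private]]]]].
have k_eq : k = 3 by apply/eqP; rewrite -(eqr_nat rat) k3 mulr1.
have r_eq : r = 2 by apply/eqP; rewrite -(eqr_nat rat) r2 mulrC divfK.
subst k r.
have [C C_gt0] := pmf_gt0_ex (placement_pmf s).
have [T CT] := delivery_ex [ffun=> false] C_gt0.
have confined_C i := realizable_confined l_gt0 s_uncoded s_decodable i CT.
have i_j : ord0 != ord_max :> user by [].
have [d [al [be C0]]] := confined_C ord0.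
have [d' [al' [be' C1]]] := confined_C ord_max.
have [d'd | d'd] := eqVneq d' d.
  rewrite d'd in C1.
  exact: (same_confined_false l_gt0 s_uncoded s_decodable s_private
    i_j CT C0 C1).
have {}d'd : d' = ~~ d by case: (d) (d') d'd => [] [].
rewrite d'd in C1.
exact: (opposite_confined_false l_gt0 s_uncoded s_decodable s_private
  i_j CT C0 C1).
Qed.
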